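(* Let $X$ be a gauge space, let $Y$ be a compact and separated gauge space, and let $g\colon X\to Y$ be a continuous map such that for all $y\in Y$ we have $g(X)\approx\{y\}$. Let $\bar g\colon\beta X\to Y$ be the unique continuous map satisfying $\bar g(\check x)=g(x)$ for all $x\in X$. Then $\bar g$ is surjective.
   Context: A metric on a set $X$ is a function $d\colon X\times X\to[0,\infty)$ with $d(x,x)=0$, $d(x,y)=d(y,x)$ and $d(x,y)+d(y,z)\ge d(x,z)$ for all $x,y,z$ (so $d(x,y)=0$ with $x\ne y$ is allowed). Write $d\ge d'$ for pointwise inequality. A gauge on $X$ is a nonempty set $\mathcal{G}$ of metrics on $X$ such that for any $d_1,d_2\in\mathcal{G}$ there is $d_3\in\mathcal{G}$ with $d_3\ge d_1$ and $d_3\ge d_2$. A gauge space is a set $X$ with a gauge; the elements of the gauge are called gauge metrics or $X$-metrics. A gauge space is separated if $d(x,y)=0$ for all gauge metrics $d$ implies $x=y$. For nonempty $A,B\subseteq X$ put $d(A,B)=\inf_{a\in A,b\in B}d(a,b)$; write $A\approx B$ if $d(A,B)=0$ for all gauge metrics $d$; by convention $\emptyset\not\approx A$ for all $A$. Write $x\approx A$ for $\{x\}\approx A$. A function $f\colon X\to Y$ of gauge spaces is continuous if $x\approx A$ in $X$ implies $f(x)\approx f(A)$ in $Y$, for all $x\in X$, $A\subseteq X$. A gauge space $X$ is totally bounded if for any $X$-metric $d$ and any $\varepsilon>0$, $X$ is a union of finitely many balls $B_d(x_i,\varepsilon)=\{y: d(y,x_i)<\varepsilon\}$. A Cauchy point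 $\xi$ of a gauge space $X$ consists of a function $\xi_d\colon X\to[0,\infty)$ for each gauge metric $d$, such that: (1) $d(x,y)+\xi_d(y)\ge\xi_d(x)$ for all $d,x,y$; (2) $\xi_d(x)+\xi_d(y)\ge d(x,y)$ for all $d,x,y$; (3) $\inf_{x\in X}\xi_d(x)=0$ for each $d$ (with $\inf\emptyset=+\infty$); (4) for any gauge metrics $d_1,d_2$ there is a gauge metric $d_3$ with $d_3\ge\max(d_1,d_2)$ and $\xi_{d_3}\ge\max(\xi_{d_1},\xi_{d_2})$. Each $z\in X$ gives a Cauchy point $\hat z$ with $\hat z_d(x)=d(z,x)$; $\xi$ is represented by $z$ if $\xi=\hat z$. $X$ is complete if every Cauchy point is represented by some point. $X$ is compact if it is totally bounded and complete. The completion $\widehat X$ of $X$ is the set of Cauchy points of $X$ with the gauge consisting of the metrics $\hat d(\xi,\zeta)=\inf_{x\in X}(\xi_d(x)+\zeta_d(x))$, one for each gauge metric $d$ of $X$. For a gauge space $X$, $\mathcal{G}_\beta$ is the gauge on the set $X$ consisting of all metrics $d_\varphi(x,y)=\max_{1\le i\le n}|\varphi_i(x)-\varphi_i(y)|$, for $n\in\mathbb{N}$ and $\varphi=(\varphi_1,\dots,\varphi_n)\colon X\to[0,1]^n$ continuous with respect to the given gauge on $X$, where $[0,1]^n$ has the single gauge metric $\max_i|a_i-b_i|$. The Stone–Čech compactification $\beta X$ is the completion of $(X,\mathcal{G}_\beta)$. For $x\in X$, $\check x\in\beta X$ denotes the Cauchy point of $(X,\mathcal{G}_\beta)$ represented by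 $x$. Known fact making $\bar g$ well-defined: for every continuous $g\colon X\to Y$ with $Y$ compact and separated there is exactly one continuous $\bar g\colon\beta X\to Y$ with $\bar g(\check x)=g(x)$ for all $x\in X$. *)

(* Defs.v *)
From mathcomp Require Import all_boot all_order all_algebra.
From mathcomp Require Import all_classical all_reals.
From mathcomp.analysis Require Import ereal.
From mathcomp Require Import lra.

Set Implicit Arguments.
Unset Strict Implicit.
Unset Printing Implicit Defensive.

Import Order.TTheory GRing.Theory Num.Theory.
Local Open Scope classical_set_scope.
Local Open Scope ring_scope.

(* Distinct points may be at distance 0. *)
Record is_metric (R : realType) (X : Type) (d : X -> X -> R) : Prop := IsMetric {
  metric_ge0 : forall x y, 0 <= d x y ;
  metric_refl : forall x, d x x = 0 ;
  metric_sym : forall x y, d x y = d y x ;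
  metric_triangle : forall x y z, d x z <= d x y + d y z }.

Definition metric_le (R : realType) (X : Type) (d d' : X -> X -> R) : Prop :=
  forall x y, d x y <= d' x y.

Record is_gauge (R : realType) (X : Type) (G : set (X -> X -> R)) : Prop := IsGauge {
  is_gauge_nonempty : G !=set0 ;
  is_gauge_metric : forall d, G d -> is_metric d ;
  is_gauge_directed : forall d1 d2, G d1 -> G d2 ->
    exists d3, [/\ G d3, metric_le d1 d3 & metric_le d2 d3] }.

Record gaugeSpace (R : realType) := GaugeSpace {
  gauge_carrier :> Type ;
  gauge : set (gauge_carrier -> gauge_carrier -> R) ;
  gaugeP : is_gauge gauge }.

Definition gaugeMetric (R : realType) (X : gaugeSpace R) : Type :=
  {d : X -> X -> R | gauge d}.

Definition metric_fun (R : realType) (X : gaugeSpace R) (d : gaugeMetric X) :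
  X -> X -> R := sval d.
Coercion metric_fun : gaugeMetric >-> Funclass.

Section gauge_spaces.
Context {R : realType}.
Implicit Types X Y : gaugeSpace R.

Definition gauge_separated X : Prop :=
  forall x y : X, (forall d : gaugeMetric X, d x y = 0) -> x = y.

Definition set_distance X (d : gaugeMetric X) (A B : set X) : R :=
  inf [set d a b | a in A & b in B].

(* The relation A ≈ B.  It never holds for an empty set; the nonemptiness
   conditions are needed because [inf set0 = 0] in a [realType]. *)
Definition near_sets X (A B : set X) : Prop :=
  [/\ A !=set0, B !=set0 & forall d : gaugeMetric X, set_distance d A B = 0].

Definition gauge_continuous X Y (f : X -> Y) : Prop :=
  forall (x : X) (A : set X), near_sets [set x] A -> near_sets [set f x] (f @` A).

Definition gauge_ball X (d : gaugeMetric X) (x : X) (e : R) : set X :=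
  [set y | d y x < e].

Definition gauge_totally_bounded X : Prop :=
  forall (d : gaugeMetric X) (e : R), 0 < e ->
    exists2 F : set X, finite_set F & [set: X] = \bigcup_(x in F) gauge_ball d x e.

(* The infimum is taken in the extended reals, where [ereal_inf set0 = +oo], so
   that an empty space has no Cauchy point. *)
Record cauchyPoint X := CauchyPoint {
  cauchy_fun :> gaugeMetric X -> X -> R ;
  cauchy_ge0 : forall d x, 0 <= cauchy_fun d x ;
  cauchy_lip : forall (d : gaugeMetric X) x y,
    cauchy_fun d x <= d x y + cauchy_fun d y ;
  cauchy_triangle : forall (d : gaugeMetric X) x y,
    d x y <= cauchy_fun d x + cauchy_fun d y ;
  cauchy_inf : forall d, ereal_inf (range (fun x => (cauchy_fun d x)%:E)) = 0%:E ;
  cauchy_directed : forall d1 d2 : gaugeMetric X, exists d3 : gaugeMetric X,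
    (forall x y, Num.max (d1 x y) (d2 x y) <= d3 x y) /\
    (forall x, Num.max (cauchy_fun d1 x) (cauchy_fun d2 x) <= cauchy_fun d3 x) }.

Lemma gaugeMetricP X (d : gaugeMetric X) : is_metric d.
Proof. by case: (gaugeP X) => _ + _; apply; case: d. Qed.

Lemma gaugeMetric_directed X (d1 d2 : gaugeMetric X) :
  exists d3 : gaugeMetric X, metric_le d1 d3 /\ metric_le d2 d3.
Proof.
have [d3 [Gd3 le1 le2]] := is_gauge_directed (gaugeP X) (svalP d1) (svalP d2).
by exists (exist _ d3 Gd3).
Qed.

Section representable.
Variables (X : gaugeSpace R) (z : X).
Let zf (d : gaugeMetric X) (x : X) : R := d z x.

Fact point_ge0 d x : 0 <= zf d x.
Proof. exact: (metric_ge0 (gaugeMetricP d)). Qed.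

Fact point_lip (d : gaugeMetric X) x y : zf d x <= d x y + zf d y.
Proof.
rewrite /zf (metric_sym (gaugeMetricP d) x y) addrC.
exact: (metric_triangle (gaugeMetricP d)).
Qed.

Fact point_triangle (d : gaugeMetric X) x y : d x y <= zf d x + zf d y.
Proof.
rewrite /zf (metric_sym (gaugeMetricP d) z x).
exact: (metric_triangle (gaugeMetricP d)).
Qed.

Fact point_inf d : ereal_inf (range (fun x => (zf d x)%:E)) = 0%:E.
Proof.
apply/eqP; rewrite eq_le; apply/andP; split.
  by apply: ereal_inf_lbound; exists z => //; rewrite /zf (metric_refl (gaugeMetricP d)).
by apply: le_ereal_inf_tmp => _ [x _ <-]; rewrite lee_fin point_ge0.
Qed.

Fact point_directed (d1 d2 : gaugeMetric X) : exists d3 : gaugeMetric X,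
  (forall x y, Num.max (d1 x y) (d2 x y) <= d3 x y) /\
  (forall x, Num.max (zf d1 x) (zf d2 x) <= zf d3 x).
Proof.
have [d3 [le1 le2]] := gaugeMetric_directed d1 d2.
exists d3; split=> [x y|x]; rewrite ge_max; apply/andP; split;
  by [exact: le1|exact: le2].
Qed.

Definition point_cauchy : cauchyPoint X :=
  CauchyPoint point_ge0 point_lip point_triangle point_inf point_directed.

End representable.

Definition gauge_complete X : Prop :=
  forall xi : cauchyPoint X, exists z : X, xi = point_cauchy z.

Definition gauge_compact X : Prop := gauge_totally_bounded X /\ gauge_complete X.

Definition completion_metric X (d : gaugeMetric X) (xi zeta : cauchyPoint X) : R :=
  inf (range (fun x => xi d x + zeta d x)).

Definition completion_gauge X : set (cauchyPoint X -> cauchyPoint X -> R) :=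
  range (@completion_metric X).

Lemma cauchy_small X (xi : cauchyPoint X) d (e : R) :
  0 < e -> exists x, xi d x < e.
Proof.
move=> e0; have : (ereal_inf (range (fun x => (xi d x)%:E)) < e%:E)%E.
  by rewrite cauchy_inf lte_fin.
by case/ereal_inf_lt => _ [x _ <-]; rewrite lte_fin; exists x.
Qed.

Lemma cauchy_le X (xi : cauchyPoint X) (d d' : gaugeMetric X) x :
  metric_le d d' -> xi d x <= xi d' x.
Proof.
move=> le_dd'; apply/ler_addgt0Pr => e e0.
have [d3 [_ le3]] := cauchy_directed xi d d'.
have e20 : 0 < e / 2 by rewrite divr_gt0.
have [y y3] := cauchy_small xi d3 e20.
have := le3 y; rewrite ge_max => /andP[y1 y2].
have := cauchy_lip xi d x y; have := cauchy_triangle xi d' x y.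
have := le_dd' x y; lra.
Qed.

Lemma completion_metric_le X (d : gaugeMetric X) (xi zeta : cauchyPoint X) x :
  completion_metric d xi zeta <= xi d x + zeta d x.
Proof.
apply: ge_inf; last by exists x.
by exists 0 => _ [y _ <-]; rewrite addr_ge0 ?cauchy_ge0.
Qed.

Lemma completion_metric_ge X (d : gaugeMetric X) (xi zeta : cauchyPoint X) (r : R) :
  (forall x, r <= xi d x + zeta d x) -> r <= completion_metric d xi zeta.
Proof.
move=> rle; apply: lb_le_inf; last by move=> _ [x _ <-].
by have [x _] := cauchy_small xi d ltr01; exists (xi d x + zeta d x), x.
Qed.

Lemma completion_metricP X (d : gaugeMetric X) : is_metric (completion_metric d).
Proof.
have ge0 xi zeta : 0 <= completion_metric d xi zeta.
  by apply: completion_metric_ge => x; rewrite addr_ge0 ?cauchy_ge0.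
split=> // [xi|xi zeta|xi zeta eta].
- apply/eqP; rewrite eq_le ge0 andbT; apply/ler_addgt0Pr => e e0.
  have e20 : 0 < e / 2 by rewrite divr_gt0.
  have [x xe] := cauchy_small xi d e20.
  by have := completion_metric_le d xi xi x; lra.
- by congr inf; congr image; apply/funext => x; rewrite addrC.
- rewrite -lerBlDl; apply: completion_metric_ge => y.
  rewrite lerBlDr addrC -lerBlDr; apply: completion_metric_ge => x.
  have := completion_metric_le d xi eta x; have := cauchy_triangle zeta d x y.
  have := cauchy_lip eta d x y; lra.
Qed.

Fact completion_gaugeP X : is_gauge (@completion_gauge X).
Proof.
split=> [|_ [d _ <-]|_ _ [d1 _ <-] [d2 _ <-]].
- have [d Gd] := is_gauge_nonempty (gaugeP X).
  by exists (completion_metric (exist _ d Gd : gaugeMetric X)); exists (exist _ d Gd).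
- exact: completion_metricP.
- have [d3 [le1 le2]] := gaugeMetric_directed d1 d2.
  exists (completion_metric d3); split; first by exists d3.
  + move=> xi zeta; apply: completion_metric_ge => x.
    by apply: le_trans (completion_metric_le _ _ _ x) _; rewrite lerD ?cauchy_le.
  + move=> xi zeta; apply: completion_metric_ge => x.
    by apply: le_trans (completion_metric_le _ _ _ x) _; rewrite lerD ?cauchy_le.
Qed.

Definition completion X : gaugeSpace R := GaugeSpace (@completion_gaugeP X).

(* For [n = 0] the maximum is empty and equal to 0. *)
Definition sup_metric n (a b : 'I_n -> R) : R := \big[Num.max/0]_(i < n) `|a i - b i|.

Lemma sup_metricP n (T : Type) (f : T -> 'I_n -> R) :
  is_metric (fun x y => sup_metric (f x) (f y)).
Proof.
rewrite /sup_metric; split=> [x y|x|x y|x y z].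
- exact: bigmax_ge_id.
- apply/eqP; rewrite eq_le bigmax_ge_id andbT; apply: bigmax_le => // i _.
  by rewrite subrr normr0.
- by apply: eq_bigr => i _; rewrite distrC.
- apply: bigmax_le => [|i _]; first by rewrite addr_ge0 ?bigmax_ge_id.
  apply: le_trans (ler_distD (f y i) _ _) _.
  by apply: lerD; [exact: (le_bigmax _ (fun i => `|f x i - f y i|))|
                   exact: (le_bigmax _ (fun i => `|f y i - f z i|))].
Qed.

Record cube_point n := CubePoint {
  cube_coord :> 'I_n -> R ;
  cube_coordP : forall i, 0 <= cube_coord i <= 1 }.

Definition cube_metric n (a b : cube_point n) : R := sup_metric a b.

Fact cube_gaugeP n : is_gauge [set @cube_metric n].
Proof.
split=> [|_ ->|_ _ -> ->]; first by exists (@cube_metric n).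
  exact: sup_metricP.
by exists (@cube_metric n); split.
Qed.

Definition unit_cube n : gaugeSpace R := GaugeSpace (cube_gaugeP n).

Definition beta_metric X n (phi : X -> unit_cube n) (x y : X) : R :=
  sup_metric (phi x) (phi y).

Definition beta_gauge X : set (X -> X -> R) :=
  [set d | exists (n : nat) (phi : X -> unit_cube n),
     gauge_continuous phi /\ d = beta_metric phi].

Lemma near_pointP X (x : X) (A : set X) :
  near_sets [set x] A <->
  forall (d : gaugeMetric X) (e : R), 0 < e -> exists2 a, A a & d x a < e.
Proof.
split=> [[_ [a0 Aa0] dA0] d e e0|small].
  have nonempty : [set d a b | a in [set x] & b in A] !=set0.
    by exists (d x a0), x => //; exists a0.
  have lb : has_lbound [set d a b | a in [set x] & b in A].
    by exists 0 => _ [? _ [? _ <-]]; exact: (metric_ge0 (gaugeMetricP d)).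
  have := inf_adherent e0 (conj nonempty lb).
  rewrite -[inf _]/(set_distance d [set x] A) dA0 add0r => -[_ [_ -> [a Aa <-]]].
  by exists a.
have [d0 Gd0] := is_gauge_nonempty (gaugeP X).
have [a0 Aa0 _] := small (exist _ d0 Gd0) 1 ltr01.
split; [by exists x|by exists a0|move=> d].
apply/eqP; rewrite eq_le; apply/andP; split.
  apply/ler_addgt0Pr => e e0; rewrite add0r.
  have [a Aa dxa] := small d e e0; apply: le_trans (ltW dxa).
  apply: ge_inf; last by exists x => //; exists a.
  by exists 0 => _ [? _ [? _ <-]]; exact: (metric_ge0 (gaugeMetricP d)).
apply: lb_le_inf; first by exists (d x a0), x => //; exists a0.
by move=> _ [? _ [? _ <-]]; exact: (metric_ge0 (gaugeMetricP d)).
Qed.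

Lemma near_pointU X (x : X) (A B : set X) :
  near_sets [set x] (A `|` B) -> near_sets [set x] A \/ near_sets [set x] B.
Proof.
move=> /near_pointP xAB; apply: contrapT => /not_orP[].
move=> /near_pointP/existsNP[d1 /existsNP[e1 /not_implyP[e10 far1]]].
move=> /near_pointP/existsNP[d2 /existsNP[e2 /not_implyP[e20 far2]]].
have [d3 [le1 le2]] := gaugeMetric_directed d1 d2.
have e0 : 0 < Num.min e1 e2 by rewrite lt_min e10.
have [a ABa] := xAB d3 _ e0; rewrite lt_min => /andP[a1 a2].
by case: ABa => [Aa|Ba]; [apply: far1|apply: far2]; exists a => //;
  apply: le_lt_trans (_ : d3 x a < _); rewrite ?le1 ?le2.
Qed.

Lemma continuous_cubeP X n (phi : X -> unit_cube n) :
  gauge_continuous phi <->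
  forall (x : X) (A : set X), near_sets [set x] A ->
  forall e, 0 < e -> exists2 a, A a & beta_metric phi x a < e.
Proof.
pose c : gaugeMetric (unit_cube n) := exist _ (@cube_metric n) erefl.
split=> [cphi x A /cphi/near_pointP small e e0|cphi x A /cphi small].
  by have [_ [a Aa <-] ?] := small c e e0; exists a.
apply/near_pointP => -[d /= dE] e e0; have [a Aa ltae] := small e e0.
by exists (phi a); [exists a|rewrite /metric_fun /= dE].
Qed.

Definition cube_pair m n (a : cube_point m) (b : cube_point n) (i : 'I_(m + n)) : R :=
  match fintype.split i with inl j => a j | inr k => b k end.

Fact cube_pairP m n (a : cube_point m) (b : cube_point n) i : 0 <= cube_pair a b i <= 1.
Proof. by rewrite /cube_pair; case: fintype.split => j; exact: cube_coordP. Qed.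

Lemma beta_metric_pair X m n (phi : X -> unit_cube m) (psi : X -> unit_cube n) :
  let chi x : unit_cube (m + n) := CubePoint (cube_pairP (phi x) (psi x)) in
  forall x y, beta_metric chi x y = Num.max (beta_metric phi x y) (beta_metric psi x y).
Proof.
move=> chi x y; apply/eqP; rewrite eq_le; apply/andP; split.
  apply: bigmax_le => [|i _]; first by rewrite le_max bigmax_ge_id.
  rewrite /chi /= /cube_pair le_max; apply/orP; case: fintype.split => j.
    by left; exact: (le_bigmax _ (fun j => `|phi x j - phi y j|)).
  by right; exact: (le_bigmax _ (fun j => `|psi x j - psi y j|)).
rewrite ge_max; apply/andP; split; apply: bigmax_le => [|j _]; try exact: bigmax_ge_id.
  apply: le_trans (le_bigmax _ (fun i => `|chi x i - chi y i|) (lshift n j)).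
  by rewrite /chi /= /cube_pair (unsplitK (inl j : 'I_m + 'I_n)).
apply: le_trans (le_bigmax _ (fun i => `|chi x i - chi y i|) (rshift m j)).
by rewrite /chi /= /cube_pair (unsplitK (inr j : 'I_m + 'I_n)).
Qed.

Fact beta_gaugeP X : is_gauge (@beta_gauge X).
Proof.
split.
- pose phi (x : X) : unit_cube 0 :=
    CubePoint (fun i : 'I_0 => match i with Ordinal _ i0 => False_ind _ (notF i0) end
      : 0 <= (fun _ : 'I_0 => 0 : R) i <= 1).
  exists (beta_metric phi); exists 0%N, phi; split=> //.
  apply/continuous_cubeP => x A [_ [a Aa] _] e e0.
  by exists a => //; rewrite /beta_metric /sup_metric big_ord0.
- by move=> _ [n [phi [_ ->]]]; exact: sup_metricP.
- move=> _ _ [m [phi [cphi ->]]] [n [psi [cpsi ->]]].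
  pose chi x : unit_cube (m + n) := CubePoint (cube_pairP (phi x) (psi x)).
  exists (beta_metric chi); split.
  + exists (m + n)%N, chi; split=> //; apply/continuous_cubeP => x A xA e e0.
    have /near_pointU : near_sets [set x]
      ((A `&` [set a | e <= beta_metric phi x a]) `|`
       (A `&` [set a | beta_metric phi x a < e])).
      rewrite -setIUr (_ : _ `|` _ = setT) ?setIT//.
      by apply/seteqP; split=> // a _; case: (leP e (beta_metric phi x a)); [left|right].
    case=> [|/(proj1 (continuous_cubeP psi) cpsi)/(_ _ e0)[a [Aa /= phia] psia]].
      move/(proj1 (continuous_cubeP phi) cphi)/(_ _ e0) => [a [_ /= lea] lta].
      by move: (le_lt_trans lea lta); rewrite ltxx.
    by exists a => //; rewrite beta_metric_pair gt_max phia.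
  + by move=> x y; rewrite beta_metric_pair le_max lexx.
  + by move=> x y; rewrite beta_metric_pair le_max lexx orbT.
Qed.

Definition beta_space X : gaugeSpace R := GaugeSpace (@beta_gaugeP X).

Definition stone_cech X : gaugeSpace R := completion (beta_space X).

Definition stone_cech_point X (x : X) : stone_cech X :=
  @point_cauchy (beta_space X) x.

End gauge_spaces.

(* Main.v *)
From mathcomp.analysis Require Import ereal.
Require Import Defs.
From mathcomp Require Import all_boot all_order all_algebra.
From mathcomp Require Import all_classical all_reals.
From mathcomp Require Import lra.

Local Open Scope classical_set_scope.

(** A point [y] of [Y] is approximated by values of [g], so the preimages under
    [g] of the balls around [y] generate a proper filter on [X]; extend it to an
    ultrafilter [U].

    The gauge of [beta_space X] only sees finitely many bounded functions at a
    time, and a bounded real function converges along every ultrafilter.  Hence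
    [U] is Cauchy for that gauge ([ultra_beta_cauchy]) and defines a point [xi]
    of the Stone-Cech compactification, namely its limit: [xi d x] is the limit
    of [d x s] as [s] runs along [U] ([filter_cauchy]).

    The point [xi] adheres to the image of every member of [U]
    ([filter_cauchy_adherent]).  By continuity [gbar xi] adheres to [g @` S] for
    every [S] in [U]; taking for [S] the preimage of a small ball around [y]
    shows that [gbar xi] is at distance 0 from [y] for every gauge metric, and
    [Y] is separated. *)

(** * The limit of a Cauchy filter *)

Section FilterCauchy.
Local Open Scope ring_scope.
Import Order.TTheory GRing.Theory Num.Theory.

Context {R : realType} {X : gaugeSpace R}.

Lemma gauge_ballE (d : gaugeMetric X) x e y :
  gauge_ball d x e y = (d x y < e) :> Prop.
Proof. by rewrite /gauge_ball /= (metric_sym (gaugeMetricP d)). Qed.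

Definition gauge_cauchy_filter (F : set_system X) : Prop :=
  forall (d : gaugeMetric X) (e : R), 0 < e -> exists z, F (gauge_ball d z e).

Variables (F : set_system X) (FF : ProperFilter F) (FC : gauge_cauchy_filter F).

(** The limit of [d x] along [F], written as an upper limit so that it makes
    sense before any convergence is known. *)
Definition filter_dist (d : gaugeMetric X) (x : X) : R :=
  inf [set t | F [set s | d x s <= t]].

Lemma filter_dist_ge0_bound (d : gaugeMetric X) x :
  lbound [set t | F [set s | d x s <= t]] 0.
Proof.
by move=> t /filter_ex[s]; apply: le_trans; exact: (metric_ge0 (gaugeMetricP d)).
Qed.

Lemma filter_dist_bounded (d : gaugeMetric X) x :
  [set t | F [set s | d x s <= t]] !=set0.
Proof.
have [z Fz] := FC d 1 ltr01; exists (d x z + 1).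
apply: filterS Fz => s; rewrite gauge_ballE /= => dzs.
by have := metric_triangle (gaugeMetricP d) x z s; lra.
Qed.

Lemma filter_dist_le {d : gaugeMetric X} {x t} :
  F [set s | d x s <= t] -> filter_dist d x <= t.
Proof. by apply: ge_inf; exists 0; exact: filter_dist_ge0_bound. Qed.

Lemma filter_dist_ge {d : gaugeMetric X} {x r} :
  (forall t, F [set s | d x s <= t] -> r <= t) -> r <= filter_dist d x.
Proof. by apply: lb_le_inf; exact: filter_dist_bounded. Qed.

Fact filter_dist_ge0 d x : 0 <= filter_dist d x.
Proof. apply: filter_dist_ge; exact: filter_dist_ge0_bound. Qed.

Fact filter_dist_lip (d : gaugeMetric X) x y :
  filter_dist d x <= d x y + filter_dist d y.
Proof.
rewrite -lerBlDl; apply: filter_dist_ge => t Ft.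
rewrite lerBlDl; apply: filter_dist_le; apply: filterS Ft => s /= dys.
by have := metric_triangle (gaugeMetricP d) x y s; lra.
Qed.

Fact filter_dist_triangle (d : gaugeMetric X) x y :
  d x y <= filter_dist d x + filter_dist d y.
Proof.
rewrite -lerBlDl; apply: filter_dist_ge => t Ft.
rewrite lerBlDl -lerBlDr; apply: filter_dist_ge => r Fr.
have [s [/= dys dxs]] := filter_ex (filterI Ft Fr).
have := metric_triangle (gaugeMetricP d) x s y.
by rewrite (metric_sym (gaugeMetricP d) s y); lra.
Qed.

(** Two points of a common ball of radius [e / 3] are [e]-close, and every
    member of the filter meets each ball that belongs to it. *)
Lemma filter_dist_small (d : gaugeMetric X) (S : set X) (e : R) :
  0 < e -> F S -> exists2 s, S s & filter_dist d s < e.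
Proof.
move=> e0 FS; have e30 : 0 < e / 3 by rewrite divr_gt0.
have [z Fz] := FC d _ e30.
have [s [Ss dzs]] := filter_ex (filterI FS Fz); exists s => //.
suff : filter_dist d s <= e / 3 + e / 3 by lra.
apply: filter_dist_le; apply: filterS Fz => u /= dzu; rewrite !gauge_ballE in dzs dzu.
have := metric_triangle (gaugeMetricP d) s z u.
by rewrite (metric_sym (gaugeMetricP d) s z); lra.
Qed.

Fact filter_dist_inf (d : gaugeMetric X) :
  ereal_inf (range (fun x => (filter_dist d x)%:E)) = 0%:E.
Proof.
apply/eqP; rewrite eq_le; apply/andP; split.
  apply/lee_addgt0Pr => e e0; rewrite add0e.
  have [s _ /ltW se] := filter_dist_small d _ e e0 filterT.
  apply: le_trans (_ : _ <= (filter_dist d s)%:E)%E _; last by rewrite lee_fin.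
  by apply: ereal_inf_lbound; exists s.
by apply: le_ereal_inf_tmp => _ [x _ <-]; rewrite lee_fin filter_dist_ge0.
Qed.

Fact filter_dist_directed (d1 d2 : gaugeMetric X) : exists d3 : gaugeMetric X,
  (forall x y, Num.max (d1 x y) (d2 x y) <= d3 x y) /\
  (forall x, Num.max (filter_dist d1 x) (filter_dist d2 x) <= filter_dist d3 x).
Proof.
have mono (d d' : gaugeMetric X) x :
    metric_le d d' -> filter_dist d x <= filter_dist d' x.
  move=> le_dd'; apply: filter_dist_ge => t Ft.
  by apply: filter_dist_le; apply: filterS Ft => s; exact: le_trans.
have [d3 [le1 le2]] := gaugeMetric_directed d1 d2.
by exists d3; split=> [x y|x]; rewrite ge_max ?le1 ?le2 ?mono.
Qed.

Definition filter_cauchy : cauchyPoint X :=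
  CauchyPoint filter_dist_ge0 filter_dist_lip filter_dist_triangle
    filter_dist_inf filter_dist_directed.

(** The distance in the completion from [filter_cauchy] to the point [s] is at
    most [filter_dist d s], which is small for suitable [s] in any member. *)
Lemma filter_cauchy_adherent (S : set X) : F S ->
  near_sets (X := completion X) [set filter_cauchy] (@point_cauchy R X @` S).
Proof.
move=> FS; apply/near_pointP => -[dhat dhatE] e e0; rewrite /metric_fun /=.
have [d _ <-] := dhatE.
have [s Ss sd] := filter_dist_small d _ e e0 FS.
exists (point_cauchy s); first by exists s.
apply: le_lt_trans sd; apply: le_trans (completion_metric_le _ _ _ s) _.
by rewrite /= (metric_refl (gaugeMetricP d)) addr0.
Qed.

End FilterCauchy.

(** * Ultrafilters are Cauchy for the Stone-Cech gauge *)

Section UltraCauchy.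
Local Open Scope ring_scope.
Import Order.TTheory GRing.Theory Num.Theory.

(** The limit is the supremum of the [t] such that [t <= f] eventually. *)
Lemma ultra_bounded_cvg (R : realType) (T : Type) (U : set_system T)
    (UU : UltraFilter U) (f : T -> R) (a b : R) : (forall s, a <= f s <= b) ->
  exists u, forall e, 0 < e -> U [set s | `|f s - u| < e].
Proof.
move=> fab; pose E := [set t | U [set s | t <= f s]].
have Ea : E a by apply: filterS filterT => s _ /=; case/andP: (fab s).
have Eb : ubound E b.
  by move=> t /filter_ex[s /= tfs]; apply: le_trans tfs _; case/andP: (fab s).
exists (sup E) => e e0.
have [t Et ltt] : exists2 t, E t & sup E - e < t.
  by apply: sup_adherent => //; split; [exists a|exists b].
have nE : ~ E (sup E + e).
  move=> /(ub_le_sup (ex_intro _ b Eb)); lra.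
have [//|Uc] := in_ultra_setVsetC [set s | sup E + e <= f s] UU.
apply: filterS (filterI Et Uc) => s [/= tfs /negP]; rewrite -ltNge => fse.
by rewrite ltr_norml; apply/andP; split; lra.
Qed.

(** Each coordinate of a map into a cube converges along the ultrafilter, so
    eventually all of them lie within [e / 2] of their limits; any point at
    which this happens is the centre of a ball belonging to the ultrafilter. *)
Lemma ultra_beta_cauchy (R : realType) (X : gaugeSpace R)
    (U : set_system (beta_space X)) (UU : UltraFilter U) :
  gauge_cauchy_filter U.
Proof.
move=> [d dE] e e0; rewrite /gauge_ball /metric_fun /=.
have [n [phi [_ ->]]] := dE.
have e20 : 0 < e / 2 by rewrite divr_gt0.
have /choice[u cvu] i := @ultra_bounded_cvg R _ _ UU (fun s => phi s i) 0 1
  (fun s => cube_coordP (phi s) i).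
have near_u : U [set s | forall i, `|phi s i - u i| < e / 2].
  by apply: filter_forall => i; exact: cvu.
have [z /= zu] := filter_ex near_u; exists z; apply: filterS near_u => s /= su.
(* A maximum over [n = 0] coordinates is 0, whence the side condition [0 < e]. *)
apply: bigmax_lt => // i _; have := su i; have := zu i.
by rewrite !ltr_norml => /andP[? ?] /andP[? ?]; apply/andP; split; lra.
Qed.

End UltraCauchy.

(** * Approximation by a map *)

Section Approximation.
Local Open Scope ring_scope.
Import Order.TTheory GRing.Theory Num.Theory.
Context {R : realType}.

Lemma near_sets_sym (X : gaugeSpace R) (A B : set X) :
  near_sets A B -> near_sets B A.
Proof.
case=> A0 B0 dAB; split=> // d; rewrite -(dAB d); congr inf.
by apply/seteqP; split=> _ [a Aa [b Bb <-]]; exists b => //; exists a => //;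
  exact: (metric_sym (gaugeMetricP d)).
Qed.

Lemma ball_preimage_filter (T : Type) (Y : gaugeSpace R) (g : T -> Y) (y : Y) :
  near_sets (range g) [set y] ->
  ProperFilter (filter_from [set de : gaugeMetric Y * R | 0 < de.2]
    (fun de => g @^-1` gauge_ball de.1 y de.2)).
Proof.
move=> /near_sets_sym/near_pointP gy.
apply: filter_from_proper => [|[d e] /= /(gy d)[_ [x _ <-] dyx]]; last first.
  by exists x; rewrite /= gauge_ballE.
apply: filter_from_filter => [|[d1 e1] [d2 e2] /= e10 e20].
  by have [d Gd] := is_gauge_nonempty (gaugeP Y); exists (exist _ d Gd, 1) => /=.
have [d3 [le1 le2]] := gaugeMetric_directed d1 d2.
exists (d3, Num.min e1 e2) => [|x]; rewrite /= /gauge_ball /= lt_min ?e10 //.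
by move=> /andP[? ?]; split; [apply: le_lt_trans (le1 _ _) _|
  apply: le_lt_trans (le2 _ _) _].
Qed.

(** The image of the preimage of a ball lies in that ball, so [p] is within
    [2 * e] of [y] for every gauge metric and every [e]. *)
Lemma separated_limit_eq (T : Type) (Y : gaugeSpace R) (g : T -> Y) (p y : Y) :
  gauge_separated Y ->
  (forall (d : gaugeMetric Y) e, 0 < e ->
     near_sets [set p] (g @` (g @^-1` gauge_ball d y e))) ->
  p = y.
Proof.
move=> sepY py; apply: sepY => d.
apply/eqP; rewrite eq_le (metric_ge0 (gaugeMetricP d)) andbT.
apply/ler_addgt0Pr => e e0; have e20 : 0 < e / 2 by rewrite divr_gt0.
have /near_pointP/(_ d _ e20)[_ [x /= xy <-] px] := py d _ e20.
have := metric_triangle (gaugeMetricP d) p (g x) y.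
by rewrite /gauge_ball /= in xy; lra.
Qed.

End Approximation.

Theorem theorem17p4 (R : realType) (X Y : gaugeSpace R)
    (Y_compact : gauge_compact Y) (Y_separated : gauge_separated Y)
    (g : X -> Y) (g_continuous : gauge_continuous g)
    (g_dense : forall y : Y, near_sets (range g) [set y])
    (gbar : stone_cech X -> Y) (gbar_continuous : gauge_continuous gbar)
    (gbar_extends : forall x : X, gbar (stone_cech_point x) = g x) :
  set_surj [set: stone_cech X] [set: Y] gbar.
Proof.
move=> y _.
have [U [UU ballU]] := ultraFilterLemma (ball_preimage_filter _ _ _ _ (g_dense y)).
pose UF : @ProperFilter (beta_space X) U := @ultra_proper _ _ UU.
pose UC := ultra_beta_cauchy R X U UU.
exists (filter_cauchy (X := beta_space X) U UF UC) => //.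
apply: (separated_limit_eq _ _ g) => // d e e0.
have US : U (g @^-1` gauge_ball d y e) by apply: ballU; exists (d, e).
have /gbar_continuous := filter_cauchy_adherent (X := beta_space X) U UF UC _ US.
rewrite image_comp (_ : gbar \o _ = g) //.
by apply/funext => x; exact: gbar_extends.
Qed.
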